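(* Let $X$ and $Y$ be Banach spaces, $C\in \mathcal{L}(X,Y)$, $(P_\lambda)_{\lambda > 0}$ a family in $\mathcal{L}(X)$, $(S(t))_{t\geq 0}$ a semigroup on $X$, $M \geq 1$ and $\omega \in \mathbb{R}$ such that $\lVert S(t) \rVert \leq M e^{\omega t}$ for all $t \geq 0$, and assume that for all $x\in X$ the mapping $[0,\infty)\ni t\mapsto \lVert C S(t) x \rVert_Y$ is measurable. Let $f,g,h\colon (0,\infty) \to (0,\infty)$ be measurable functions such that $f$ and $h$ are strictly monotonically increasing and bijective, and $\lambda\mapsto \lambda / g(f^{-1}(\lambda))$ is monotonically decreasing on $(0,\infty)$. Let $T>0$ and assume that $\lambda_T \geq 0$ satisfies \[ \int_{\lambda_T}^\infty h^{-1}\left(4\frac{\lambda}{g(f^{-1}(\lambda))}\right)\frac{1}{\lambda} \, d\lambda \le \frac{\ln(2)}{4}\min\{1,T\}. \] Furthermore, let $C_1\geq 0$, $C_2\geq 1$ and assume that \[ \forall \lambda >0,\ x\in X: \quad \lVert P_\lambda x \rVert_{X} \le C_1 e^{f(\lambda)} \lVert C P_\lambda x \rVert_{Y} \] and \[ \forall \lambda>0,\ t\in (0,T],\ x\in X: \quad \lVert (\mathrm{Id}-P_\lambda) S(t) x \rVert_{X} \le C_2 e^{-g(\lambda)h(t)+\omega t} \lVert x \rVert_{X}. \] Then there is a constant $C_{\mathrm{obs}}\ge 0$ such that \[ \forall x\in X: \quad \lVert S(T)x\rVert_X\leq C_{\mathrm{obs}} \int_0^T \lVert C S(\tau) x \rVert_{Y}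 \, d\tau \quad \text{and}\quad C_{\mathrm{obs}} \le \frac{C_3}{T}e^{6\lambda_T + \omega_+ T}, \] where $\omega_+ = \max\{\omega,0\}$ and \[ C_3 = 8 e^3 M C_1\left(M \left(C_1\lVert C \rVert_{\mathcal{L}(X,Y)}+1\right)C_2\right)^{\frac{6}{e \ln(2)}}. \]
   Context: $\mathcal{L}(X,Y)$ denotes the bounded linear operators from $X$ to $Y$, and $\mathcal{L}(X)=\mathcal{L}(X,X)$. A semigroup $(S(t))_{t\ge0}$ on $X$ is a family in $\mathcal{L}(X)$ with $S(0)=\mathrm{Id}$ and $S(t+s)=S(t)S(s)$ for all $s,t\ge 0$; strong continuity is not assumed. $f^{-1},h^{-1}$ denote inverse functions. *)

(* Defs.v *)
From HB Require Import structures.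
From mathcomp Require Export all_boot all_order all_algebra.
From mathcomp Require Export all_classical all_reals all_analysis.
Export Order.TTheory GRing.Theory Num.Theory.
Export numFieldNormedType.Exports.

Set Implicit Arguments.
Unset Strict Implicit.
Unset Printing Implicit Defensive.

Local Open Scope classical_set_scope.
Local Open Scope ring_scope.

(* Banach spaces are taken over the reals; complex ones are included by
   restriction of scalars, which changes neither norms nor operator norms. *)
Section BoundedOperators.
Context {R : realType} (X Y : normedModType R).

Record bounded_op := BoundedOp {
  op_linear :> {linear X -> Y};
  op_bounded : bounded_near op_linear (nbhs (0 : X)) }.

Definition op_norm (A : bounded_op) : R :=
  sup [set `|A x| | x in [set x : X | `|x| <= 1]].

End BoundedOperators.

Notation "''L' ( X , Y )" := (bounded_op X Y)
  (at level 8, format "''L' ( X ,  Y )") : type_scope.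

(* Only the values S t with 0 <= t are meaningful. *)
Definition semigroup (R : realType) (X : normedModType R) (S : R -> 'L(X, X)) :=
  (forall x, S 0 x = x) /\
  (forall s t, 0 <= s -> 0 <= t -> forall x, S (t + s) x = S t (S s x)).

(* The Caratheodory sigma-algebra of the outer measure generated by interval
   length is that of the Lebesgue measurable sets, on which
   completed_lebesgue_measure is defined; the plain lebesgue_measure of the
   library lives on the Borel sets. *)
Notation lebesgueType R := (caratheodory_type ((wlength (@idfun R))^*)%mu).

Definition lebesgue_measurable_fun (R : realType) (D : set R) (f : R -> R) :=
  measurable_fun (D : set (lebesgueType R)) (f : lebesgueType R -> R).

Definition pos_reals (R : realType) : set R := `]0, +oo[%classic.
Arguments pos_reals {R}.

(* The inverse of a bijection of ]0, +oo[; arbitrary outside ]0, +oo[. *)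
Definition pos_inv (R : realType) (f : R -> R) : R -> R := pinv pos_reals f.

(* Main.v *)
Require Import Defs.
(* Without this direct import no canonical measurable structure on \bar R is
   found. *)
From mathcomp Require Import measurable_realfun lra ring.

(** Write F t = |S t x| and G t = |C (S t x)|.  On an interval [a, b] of length
    2 tau, the uncertainty relation at frequency level mu = f l, the dissipation
    estimate over times at least tau with g l * h tau >= 4 mu, and an average
    over the second half of the interval give
      F b <= e^(omega (b - a)) (M C1 e^mu / tau * int_a^b G + K e^(-3 mu) F a)
    with K = M (C1 |C| + 1) C2.  This is iterated backwards from T with
    mu_k = 2^k mu_0, mu_0 = 2 lambda_T + 1 + 2 / (e ln 2) * ln K, and
    tau_k = h^-1 (4 mu_k / g (f^-1 mu_k)) + T / 2^(k + 3).  Comparing the first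
    summands with the integral over the dyadic intervals ]mu_k / 2, mu_k] shows
    that they add up to at most T / 4, so the iteration never leaves [0, T]; the
    second summands bound 1 / tau_k. *)

Local Open Scope classical_set_scope.
Local Open Scope ring_scope.

(** * Boundedness and the operator norm *)

Lemma op_norm_has_ubound {R : realType} {X Y : normedModType R} (A : 'L(X, Y)) :
  has_ubound [set `|A x| | x in [set x : X | `|x| <= 1]].
Proof.
have /linear_boundedP/pinfty_ex_gt0[r r0 Ar] := op_bounded A.
exists r => _ [y /= y1 <-]; apply: le_trans (Ar y) _.
by rewrite ler_piMr// ltW.
Qed.

Lemma op_norm_ge0 {R : realType} {X Y : normedModType R} (A : 'L(X, Y)) :
  0 <= op_norm A.
Proof.
apply: ub_le_sup; first exact: op_norm_has_ubound.
by exists 0; rewrite /= ?linear0 normr0.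
Qed.

Lemma ler_op_norm {R : realType} {X Y : normedModType R} (A : 'L(X, Y)) (x : X) :
  `|A x| <= op_norm A * `|x|.
Proof.
have [->|x0] := eqVneq x 0; first by rewrite linear0 !normr0 mulr0.
rewrite -ler_pdivrMr ?normr_gt0//.
apply: ub_le_sup; first exact: op_norm_has_ubound.
exists (`|x|^-1 *: x) => /=.
  by rewrite normrZ normfV normr_id mulVf// normr_eq0.
by rewrite linearZ/= normrZ normfV normr_id mulrC.
Qed.

(** * Inverse functions on the positive half-line *)

Section PosInv.
Context {R : realType} {f : R -> R}.
Hypothesis f_bij : set_bij pos_reals pos_reals f.
Implicit Types r s : R.

Lemma pos_inv_gt0 s : 0 < s -> 0 < pos_inv f s.
Proof.
move=> s0; have [_ _ fs] := f_bij.
have /(_ _ (pos_inv f s)) := surjpinv_image_sub fs.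
rewrite /pos_reals/= in_itv/= andbT; apply; exists s => //=.
by rewrite in_itv/= s0.
Qed.

Lemma pos_invK s : 0 < s -> f (pos_inv f s) = s.
Proof.
move=> s0; have [_ _ fs] := f_bij.
by rewrite /pos_inv (surjpK _ fs)// inE /pos_reals/= in_itv/= s0.
Qed.

Lemma le_pos_inv (f_increasing : forall r s, 0 < r -> r < s -> f r < f s) r s :
  0 < r -> r <= s -> pos_inv f r <= pos_inv f s.
Proof.
move=> r0 rs; rewrite leNgt; apply/negP => /f_increasing.
have s0 := lt_le_trans r0 rs.
by move/(_ (pos_inv_gt0 _ s0)); rewrite !pos_invK// ltNge rs.
Qed.

End PosInv.

(* The integral of a nonnegative function is a supremum over the simple functions
   below it, so that monotonicity needs no measurability. *)
Lemma ge0_le_integral_nonmeasurable d (T : measurableType d) (R : realType)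
    (mu : {measure set T -> \bar R}) (D : set T) (f1 f2 : T -> \bar R) :
  (forall x, D x -> 0 <= f1 x)%E -> (forall x, D x -> f1 x <= f2 x)%E ->
  (\int[mu]_(x in D) f1 x <= \int[mu]_(x in D) f2 x)%E.
Proof.
move=> f10 f12.
have f20 x : D x -> (0 <= f2 x)%E.
  by move=> Dx; exact: le_trans (f10 _ Dx) (f12 _ Dx).
rewrite !ge0_integralE//; apply: ereal_sup_le => _ [h /= hf <-]; exists h => //= x.
by apply: le_trans (hf x) _; exact: lee_restrict.
Qed.

(** * Integrals against the completed Lebesgue measure *)

Section CompletedLebesgue.
Context {R : realType}.
Local Notation mu := (@lebesgue_measure R).
Local Notation cmu := (@completed_lebesgue_measure R).

Lemma lebesgueType_measurable (A : set R) :
  measurable A -> measurable (A : set (lebesgueType R)).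
Proof. exact: sub_caratheodory. Qed.

Lemma measurable_idfun_lebesgueType :
  measurable_fun [set: lebesgueType R] (idfun : lebesgueType R -> measurableTypeR R).
Proof. by move=> _ A mA; rewrite setTI; exact: lebesgueType_measurable. Qed.

Lemma lebesgueType_measurable_fun d (U : measurableType d) (D : set R)
    (f : R -> U) : measurable D -> measurable_fun D f ->
  measurable_fun (D : set (lebesgueType R)) (f : lebesgueType R -> U).
Proof. by move=> mD mf _ A mA; apply: lebesgueType_measurable; exact: mf. Qed.

(** The identity from the Lebesgue to the Borel sigma-algebra is measurable and pushes [cmu] forward
    to [mu]; the claim is the change of variables along it. *)
Lemma ge0_integral_completed (D : set R) (f : R -> \bar R) :
  measurable D -> measurable_fun D f -> (forall x, D x -> 0 <= f x)%E ->
  (\int[cmu]_(x in D) f x = \int[mu]_(x in D) f x)%E.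
Proof.
move=> mD mf f0.
have f0' : {in D, forall x, 0 <= f x}%E by move=> x /set_mem; exact: f0.
exact: esym (ge0_integral_pushforward measurable_idfun_lebesgueType cmu mD mf f0').
Qed.

Lemma completed_lebesgue_measure_itv_bnd (a b : R) : a <= b ->
  cmu (`]a, b]%classic) = (b - a)%:E.
Proof.
move=> ab; transitivity (mu `]a, b]%classic) => //.
rewrite lebesgue_measure_itv/= lte_fin EFinB.
by case: ltgtP ab => // ->; rewrite subee.
Qed.

Lemma measurable_inv_itv (a b : R) : 0 < a ->
  measurable_fun `]a, b] (@GRing.inv R).
Proof.
move=> a0; apply: subspace_continuous_measurable_fun => //.
apply: continuous_in_subspaceT => x /[!inE]/=; rewrite in_itv/= => /andP[ax _].
by apply: inv_continuous; rewrite gt_eqF// (lt_trans a0).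
Qed.

(** The measure [dl / l] is invariant under scaling, so all dyadic blocks have the same weight
    [ln 2]. *)
Lemma integral_inv_doubling (a : R) : 0 < a ->
  (\int[cmu]_(x in `]a, (2 * a)%R]) (x^-1%R)%:E = (ln 2)%:E)%E.
Proof.
move=> a0; have a2a : a < 2 * a by rewrite ltr_pMl// ltr1n.
have inv_cont : {within `[a, 2 * a], continuous (@GRing.inv R)}.
  apply: continuous_in_subspaceT => x /[!inE]/=; rewrite in_itv/= => /andP[ax _].
  by apply: inv_continuous; rewrite gt_eqF// (lt_le_trans a0).
have inv_meas : measurable_fun `]a, 2 * a] (fun x : R => (x^-1)%:E).
  by apply/measurable_EFinP; exact: measurable_inv_itv.
rewrite ge0_integral_completed//; last first.
- move=> x /=; rewrite in_itv/= => /andP[ax _].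
  by rewrite lee_fin invr_ge0 ltW// (lt_trans a0).
rewrite integral_itv_obnd_cbnd//.
rewrite (continuous_FTC2 a2a inv_cont (F := @ln R)).
- by rewrite -EFinB lnM ?posrE// addrK.
- split.
  + move=> x; rewrite in_itv/= => /andP[ax _].
    by apply: ex_derive; apply: is_derive1_ln; exact: lt_trans ax.
  + by apply: cvg_at_right_filter; exact: continuous_ln.
  + by apply: cvg_at_left_filter; apply: continuous_ln; rewrite mulr_gt0.
- move=> x; rewrite in_itv/= => /andP[ax _].
  by rewrite derive1E; have [_ ->] := is_derive1_ln (lt_trans a0 ax).
Qed.

End CompletedLebesgue.

Lemma ln2_gt0 (R : realType) : 0 < ln 2 :> R.
Proof. by rewrite ln_gt0// ltr1n. Qed.

(** * Comparison of a dyadic sum with an integral *)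

Section DyadicSum.
Context {R : realType} (p : R -> R) (a m : R).
Local Notation cmu := (@completed_lebesgue_measure R).
Hypotheses (m_gt0 : 0 < m) (a_ge0 : 0 <= a) (am : a <= m).
Hypothesis p_ge0 : forall l, 0 < l -> 0 <= p l.
Hypothesis p_ni : forall l l', 0 < l -> l <= l' -> p l' <= p l.
Let mk k := 2 ^+ k * m.

(** On each block [p] is frozen at the right end, where it is smallest, so [step k] stays below
    [p l / l] there and still integrates to [p (mk k.+1) * ln 2]. *)
Let step k : R -> R := (fun l => p (mk k.+1) * l^-1) \_ `]mk k, mk k.+1].

Let mk_gt0 k : 0 < mk k.
Proof. by rewrite /mk mulr_gt0// exprn_gt0. Qed.

Let mkS k : mk k.+1 = 2 * mk k.
Proof. by rewrite /mk exprS mulrA. Qed.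

Let le_mk k : mk k <= mk k.+1.
Proof. by rewrite mkS ler_peMl// ?ler1n// ltW. Qed.

Let m_le_mk k : m <= mk k.
Proof. by rewrite /mk ler_peMl ?exprn_ege1 ?ler1n// ltW. Qed.

Let step_ge0 k l : 0 <= step k l.
Proof.
rewrite /step patchE; case: ifPn => // /set_mem/=; rewrite in_itv/= => /andP[kl _].
by rewrite mulr_ge0 ?p_ge0// invr_ge0 ltW// (lt_trans _ kl).
Qed.

(** The blocks are disjoint, so at most one summand is nonzero. Recording that the sum vanishes
    beyond [mk n] lets the induction add the next block. *)
Let sum_step_le n l : 0 < l ->
  \sum_(k < n) step k l <= if l <= mk n then p l * (1 / l) else 0.
Proof.
move=> l0; have pl0 : 0 <= p l * (1 / l) by rewrite mulr_ge0 ?p_ge0// divr_ge0// ltW.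
elim: n => [|n IH]; first by rewrite big_ord0; case: ifP.
rewrite big_ord_recr/=; case: (leP l (mk n)) IH => [lmn|mnl] IH.
  rewrite (le_trans lmn (le_mk n)) [step n l]patchE memNset ?addr0//=.
  by rewrite in_itv/= ltNge lmn.
have sum0 : \sum_(k < n) step k l = 0.
  by apply/eqP; rewrite eq_le IH sumr_ge0.
rewrite sum0 add0r [step n l]patchE; case: ifPn => [/set_mem/=|_].
  rewrite in_itv/= => /andP[_ lmn]; rewrite lmn div1r ler_wpM2r ?invr_ge0 ?(ltW l0)//.
  exact: p_ni.
by case: ifP.
Qed.

Let mulinv_meas c k :
  measurable_fun `]mk k, mk k.+1] (fun l : R => (c * l^-1)%:E).
Proof.
apply/measurable_EFinP; apply: measurable_funM; first exact: measurable_cst.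
exact: measurable_inv_itv.
Qed.

Lemma sum_doubling_le_integral n :
  (((\sum_(k < n) p (2 ^+ k.+1 * m)) * ln 2)%:E <=
    \int[cmu]_(l in `]a, +oo[) (p l * (1 / l))%:E)%E.
Proof.
have itv_meas (i : interval R) : measurable ([set` i] : set (lebesgueType R)).
  by apply: lebesgueType_measurable; exact: measurable_itv.
have stepE k : (fun l => (step k l)%:E) =
    (fun l : R => (p (mk k.+1) * l^-1)%:E) \_ `]mk k, mk k.+1].
  by apply/funext => l; rewrite /step/= !patchE; case: ifP.
have step_meas k : measurable_fun (`]a, +oo[ : set (lebesgueType R))
    (fun l : lebesgueType R => (step k l)%:E).
  rewrite stepE.
  apply: (@lebesgueType_measurable_fun _ _ _ `]a, +oo[ _) => //.
  apply/measurable_restrict => //.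
  apply: measurable_funS (mulinv_meas _ k) => //.
have int_step k : (\int[cmu]_(l in `]a, +oo[) (step k l)%:E =
    (p (mk k.+1) * ln 2)%:E)%E.
  rewrite stepE.
  rewrite -integral_mkcondr setIidr; last first.
    move=> l /=; rewrite !in_itv/= andbT => /andP[kl _].
    by apply: le_lt_trans kl; exact: le_trans (m_le_mk k).
  under eq_integral do rewrite EFinM.
  rewrite ge0_integralZl_EFin//.
  - by rewrite mkS integral_inv_doubling.
  - move=> l /=; rewrite in_itv/= => /andP[kl _].
    by rewrite lee_fin invr_ge0 ltW// (lt_trans _ kl).
  - apply: lebesgueType_measurable_fun => //.
    by apply/measurable_EFinP; exact: measurable_inv_itv.
  - exact: p_ge0.
apply: (@le_trans _ _ (\int[cmu]_(l in `]a, +oo[) (\sum_(k < n) (step k l)%:E))%E).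
  rewrite ge0_integral_sum//.
    rewrite [leRHS](eq_bigr (fun k : 'I_n => (p (mk k.+1) * ln 2)%:E)); last first.
      by move=> k _; exact: int_step.
    by rewrite sumEFin mulr_suml.
  by move=> k l _; rewrite lee_fin.
(* Only the step functions have been shown measurable; for [p] the pointwise bound is enough
   here. *)
apply: ge0_le_integral_nonmeasurable => l /=; rewrite in_itv/= andbT => al.
  by rewrite sume_ge0// => k _; rewrite lee_fin.
have l0 := le_lt_trans a_ge0 al.
rewrite sumEFin lee_fin (le_trans (sum_step_le n _ l0))//; case: ifP => // _.
by rewrite mulr_ge0 ?p_ge0// divr_ge0// ltW.
Qed.

End DyadicSum.

(** * Backward iteration of a one-step estimate *)

(** Stands in for letting the number of steps tend to infinity; [n < 2 ^ n] makes the error term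
    arbitrarily small. *)
Lemma ler_of_halving (R : realType) (x y c : R) :
  (forall n, x <= y + c / 2 ^+ n) -> x <= y.
Proof.
move=> xy; apply/ler_addgt0Pr => e e0.
pose n := Num.bound (`|c| / e); apply: le_trans (xy n) _; rewrite lerD2l.
rewrite ler_pdivrMr ?exprn_gt0// (le_trans (ler_norm c))//.
rewrite mulrC -ler_pdivrMr//.
have /ltW/le_trans -> // : `|c| / e < n%:R by exact/archi_boundP/divr_ge0/ltW.
by rewrite -natrX ler_nat ltnW// ltn_expl.
Qed.

(* The constant [2 / (e ln 2)] comes from [e k ln 2 <= 2 ^ k], that is, from
   [e y <= exp y] at [y = k ln 2]. *)
Lemma geometric_le_expR (R : realType) (K m : R) k : 1 <= K ->
  1 + 2 / (expR 1 * ln 2) * ln K <= m ->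
  (2 * K) ^+ k <= expR (2 ^+ k.+1 * m).
Proof.
move=> K1 Km.
have pow2 : 2 ^+ k = expR (k%:R * ln 2) :> R by rewrite expRM_natl lnK// posrE.
have e_gt0 : 0 < expR 1 * ln 2 :> R by rewrite mulr_gt0 ?expR_gt0 ?ln2_gt0.
have k_le : k%:R * (expR 1 * ln 2) <= 2 ^+ k :> R.
  have := expR_ge1Dx (k%:R * ln 2 - 1 : R).
  rewrite addrC subrK expRD expRN -pow2 ler_pdivlMr ?expR_gt0//.
  by rewrite mulrCA mulrA mulrC mulrA mulrC.
have lnK0 := ln_ge0 K1.
(* The factor [2 ^ k] is absorbed by the summand [1] of the lower bound on [m], through
   [2 ^ k <= exp (2 ^ k)], and [K ^ k] by the multiple of [ln K]. *)
rewrite exprMn; apply: (@le_trans _ _ (expR (2 ^+ k) * expR (k%:R * ln K))).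
  rewrite expRM_natl lnK ?posrE ?(lt_le_trans ltr01)//.
  rewrite ler_wpM2r ?exprn_ge0 ?(le_trans ler01)//.
  by rewrite (le_trans _ (expR_ge1Dx _))// lerDr.
rewrite -expRD ler_expR; apply: le_trans (ler_wpM2l _ Km); last by rewrite exprn_ge0.
rewrite mulrDr mulr1 exprS lerD ?ler_peMl ?exprn_ge0 ?ler1n//.
rewrite mulrA ler_wpM2r// mulrA ler_pdivlMr//.
apply: le_trans k_le _; have : 0 <= 2 ^+ k :> R by rewrite exprn_ge0.
by lra.
Qed.

(* After [k] steps the remainder carries [K ^ k exp (- 3 m (2 ^ k - 1))], which
   beats the observation cost [exp (2 ^ k m)] and the factor [2 ^ k] coming from
   [1 / tau k]. *)
Lemma telescoping_estimate (R : realType) (K A w T m J B : R) (t F j tau : nat -> R) :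
  1 <= K -> 0 <= A -> 0 <= w -> 0 < T -> 0 <= J ->
  1 + 2 / (expR 1 * ln 2) * ln K <= m ->
  t 0%N = T -> (forall k, 0 <= t k) -> (forall k, t k.+1 <= t k) ->
  (forall k, T / 2 ^+ k.+3 <= tau k) ->
  (forall k, 0 <= j k) -> (forall n, \sum_(k < n) j k <= J) ->
  (forall k, F k <= B) ->
  (forall k, F k <= expR (w * (t k - t k.+1)) *
    (A * expR (2 ^+ k * m) / tau k * j k + K * expR (- 3 * (2 ^+ k * m)) * F k.+1)) ->
  F 0%N <= 8 / T * A * expR (3 * m) * expR (w * T) * J.
Proof.
move=> K1 A0 w0 T0 J0 Km tT t0 tdec tauT j0 jJ FB Fstep.
have K0 : 0 <= K := le_trans ler01 K1.
have m0 : 0 <= m.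
  apply: le_trans Km; rewrite addr_ge0// mulr_ge0 ?ln_ge0//.
  by rewrite divr_ge0// mulr_ge0 ?expR_ge0// ltW// ln2_gt0.
pose D := 8 / T * A * expR (3 * m).
have D0 : 0 <= D by rewrite !mulr_ge0 ?expR_ge0 ?invr_ge0// ltW.
(* The exponent [- 3 * (2 ^ n * m) + 3 * m] is the sum of [- 3 * (2 ^ k * m)] over [k < n]. *)
have iter n : F 0%N <= expR (w * (T - t n)) *
    (D * \sum_(k < n) j k + K ^+ n * expR (- 3 * (2 ^+ n * m) + 3 * m) * F n).
  elim: n => [|n IH].
    rewrite tT subrr mulr0 expR0 big_ord0 mulr0 add0r !expr0 !mul1r.
    by rewrite mulNr addNr expR0 mul1r.
  apply: le_trans IH _.
  have -> : w * (T - t n.+1) = w * (T - t n) + w * (t n - t n.+1) by ring.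
  rewrite [expR (_ + w * _)]expRD -[leRHS]mulrA ler_wpM2l ?expR_ge0//.
  set Q := expR (- 3 * (2 ^+ n * m) + 3 * m).
  have KF := ler_wpM2l (mulr_ge0 (exprn_ge0 n K0) (expR_ge0 _ : 0 <= Q)) (Fstep n).
  apply: le_trans (lerD (lexx _) KF) _.
  rewrite big_ord_recr/=.
  (* The observations collected so far also receive the new growth factor, which is harmless since
     it is at least [1]. *)
  have wt1 : 1 <= expR (w * (t n - t n.+1)).
    by rewrite -expR0 ler_expR mulr_ge0// subr_ge0.
  set E := expR (w * (t n - t n.+1)).
  have sum0 : 0 <= \sum_(k < n) j k by rewrite sumr_ge0.
  have tau0 : 0 < tau n by apply: lt_le_trans (tauT n); rewrite divr_gt0 ?exprn_gt0.
  (* Decay and cost combine to [exp (- 2 ^ (n + 1) m)], which beats [K ^ n] and leaves [1 / 2 ^ n].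
     This cancels the growth in [1 / tau n <= 8 * 2 ^ n / T], so one [D] serves for all [n]. *)
  have coef : K ^+ n * Q * (A * expR (2 ^+ n * m) / tau n) <= D.
    have -> : K ^+ n * Q * (A * expR (2 ^+ n * m) / tau n) =
        A * expR (3 * m) * (K ^+ n * expR (- (2 ^+ n.+1 * m)) / tau n).
      have -> : - (2 ^+ n.+1 * m) = - 3 * (2 ^+ n * m) + 2 ^+ n * m.
        by rewrite exprS; ring.
      rewrite /Q expRD.
      by rewrite expRD; ring.
    rewrite /D (_ : 8 / T * A * expR (3 * m) = A * expR (3 * m) * (8 / T)); last by ring.
    rewrite ler_wpM2l ?mulr_ge0 ?expR_ge0// ler_pdivrMr//.
    apply: (@le_trans _ _ (2 ^+ n)^-1).
      rewrite expRN ler_pdivrMr ?expR_gt0// mulrC ler_pdivlMr ?exprn_gt0//.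
      by rewrite mulrC -exprMn geometric_le_expR.
    have := ler_wpM2l (divr_ge0 (ler0n _ 8) (ltW T0)) (tauT n).
    apply: le_trans; rewrite mulrA divfK ?gt_eqF// !exprS !invfM.
    by rewrite -[leLHS]mul1r !mulrA ler_wpM2r ?invr_ge0 ?exprn_ge0//; lra.
  have next : K ^+ n * Q * (K * expR (- 3 * (2 ^+ n * m))) =
      K ^+ n.+1 * expR (- 3 * (2 ^+ n.+1 * m) + 3 * m).
    rewrite [K ^+ n.+1]exprS.
    have -> : - 3 * (2 ^+ n.+1 * m) + 3 * m =
      (- 3 * (2 ^+ n * m) + 3 * m) + - 3 * (2 ^+ n * m) by rewrite exprS; ring.
    by rewrite [in RHS]expRD -/Q; ring.
  have jn0 := j0 n.
  apply: (@le_trans _ _ (E * (D * \sum_(k < n) j k) +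
      (K ^+ n * Q * (E * (A * expR (2 ^+ n * m) / tau n * j n)) +
       E * (K ^+ n * Q * (K * expR (- 3 * (2 ^+ n * m))) * F n.+1)))).
    rewrite lerD//; first by rewrite ler_peMl// mulr_ge0.
    by rewrite le_eqVlt; apply/orP; left; apply/eqP; ring.
  rewrite next [D * (_ + _)]mulrDr -[_ + D * j n + _]addrA !mulrDr lerD2l lerD2r.
  rewrite mulrCA ler_wpM2l ?expR_ge0// mulrA ler_wpM2r//.
(* Since [F] is bounded by [B], the remainder after [n] steps is at most a fixed multiple of
   [1 / 2 ^ n]. *)
apply: (@ler_of_halving _ _ _ (expR (w * T) * expR (3 * m) * `|B|)) => n.
rewrite -/D; apply: le_trans (iter n) _.
have tn : expR (w * (T - t n)) <= expR (w * T).
  by rewrite ler_expR ler_wpM2l// gerBl.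
have rest : K ^+ n * expR (- 3 * (2 ^+ n * m) + 3 * m) * F n <=
    expR (3 * m) * `|B| / 2 ^+ n.
  have coef : K ^+ n * expR (- 3 * (2 ^+ n * m) + 3 * m) <= expR (3 * m) / 2 ^+ n.
    rewrite expRD mulrA mulrC ler_wpM2l ?expR_ge0// mulNr expRN.
    rewrite ler_pdivrMr ?expR_gt0// mulrC ler_pdivlMr ?exprn_gt0//.
    rewrite mulrC -exprMn (le_trans (geometric_le_expR _ _ _ n K1 Km))//.
    rewrite ler_expR exprS -mulrA ler_wpM2r ?mulr_ge0 ?exprn_ge0//; lra.
  rewrite [leRHS]mulrAC.
  apply: (@le_trans _ _ (K ^+ n * expR (- 3 * (2 ^+ n * m) + 3 * m) * `|B|)).
    by rewrite ler_wpM2l ?mulr_ge0 ?exprn_ge0 ?expR_ge0// (le_trans (FB n))// ler_norm.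
  by rewrite ler_wpM2r.
have R0 : 0 <= D * J + expR (3 * m) * `|B| / 2 ^+ n.
  by apply: addr_ge0; [exact: mulr_ge0 | rewrite divr_ge0 ?mulr_ge0 ?expR_ge0 ?exprn_ge0].
apply: (@le_trans _ _ (expR (w * T) * (D * J + expR (3 * m) * `|B| / 2 ^+ n))).
  apply: (@le_trans _ _ (expR (w * (T - t n)) * (D * J + expR (3 * m) * `|B| / 2 ^+ n))).
    by rewrite ler_wpM2l ?expR_ge0// lerD// ler_wpM2l.
  by rewrite ler_wpM2r.
by rewrite le_eqVlt; apply/orP; left; apply/eqP; ring.
Qed.

(** * Real-valued integrals over half-open intervals *)

Section IntervalIntegral.
Context {R : realType} (G : R -> R) (T : R).
Local Notation cmu := (@completed_lebesgue_measure R).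
Hypotheses (G_ge0 : forall t, 0 <= G t).
Hypothesis G_int : cmu.-integrable `[0, T] (EFin \o G).

(** Half-open intervals make adjacent pieces disjoint, so that additivity needs no argument about
    null sets. *)
Definition itv_integral (a b : R) : R := \int[cmu]_(t in `]a, b]) G t.
Local Notation J := itv_integral.

Let itv_meas (i : interval R) : measurable ([set` i] : set (lebesgueType R)).
Proof. by apply: lebesgueType_measurable; exact: measurable_itv. Qed.

Let itv_int (a b : R) : 0 <= a -> b <= T -> cmu.-integrable `]a, b] (EFin \o G).
Proof.
move=> a0 bT; apply: integrableS G_int => //.
by apply: subset_itv; rewrite bnd_simp.
Qed.

Lemma itv_integral_ge0 (a b : R) : 0 <= J a b.
Proof. by apply: Rintegral_ge0 => t _. Qed.

Lemma itv_integralD (a b c : R) : 0 <= a -> a <= b -> b <= c -> c <= T ->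
  J a c = J a b + J b c.
Proof.
move=> a0 ab bc cT; rewrite /itv_integral.
have acE : `]a, c]%classic = `]a, b]%classic `|` `]b, c]%classic.
  by rewrite -itv_bndbnd_setU// bnd_simp.
rewrite acE.
rewrite Rintegral_setU//.
  by rewrite -acE; exact: itv_int.
rewrite disj_set2E; apply/eqP/seteqP; split=> // t [] /=.
by rewrite !in_itv/= => /andP[_ tb] /andP[bt _]; move: (le_lt_trans tb bt); rewrite ltxx.
Qed.

(** The nonnegative part over []a, m]] is dropped: in the application, dissipation has acted long
    enough only after [m]. *)
Lemma le_itv_integral (a m b c k : R) : 0 <= a -> a <= m -> m <= b -> b <= T ->
  0 <= k -> (forall t, m < t -> t <= b -> c <= k * G t) ->
  c * (b - m) <= k * J a b.
Proof.
move=> a0 am mb bT k0 cG; have m0 := le_trans a0 am.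
suff le_mb : c * (b - m) <= k * J m b.
  by rewrite (itv_integralD _ m)// [leRHS]mulrDr ler_wpDl// mulr_ge0 ?itv_integral_ge0.
rewrite /itv_integral -RintegralZl//; last exact: itv_int.
have <- : \int[cmu]_(t in `]m, b]) c = c * (b - m).
  by rewrite Rintegral_cst//= completed_lebesgue_measure_itv_bnd.
apply: le_Rintegral => //.
- apply: measurable_bounded_integrable => //.
  + by rewrite /= completed_lebesgue_measure_itv_bnd// ltry.
  + exact: bounded_cst.
- rewrite (_ : _ \o _ = fun t => (k%:E * (EFin \o G) t)%E)//.
  by apply: integrableZl => //; exact: itv_int.
- by move=> t /=; rewrite in_itv/= => /andP[mt tb]; exact: cG.
Qed.

(** Returns to the extended-valued integral over the closed interval; an inequality suffices, so
    inclusion of the domains settles the endpoint [0]. *)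
Lemma itv_integral_le : ((J 0 T)%:E <= \int[cmu]_(t in `[0%R, T]) (G t)%:E)%E.
Proof.
rewrite /itv_integral /Rintegral fineK; last first.
  by apply: integrable_fin_num => //; exact: itv_int.
apply: ge0_subset_integral; [exact: itv_meas | exact: itv_meas | | |].
- by case/integrableP : G_int.
- by move=> t _; rewrite lee_fin.
- by apply: subset_itv; rewrite bnd_simp.
Qed.

End IntervalIntegral.

(** * The estimate on a single time interval *)

Section OneStep.
Context {R : realType} {X Y : completeNormedModType R}.
Context {C : 'L(X, Y)} {P S : R -> 'L(X, X)} {M w : R} {f g h : R -> R} {T C1 C2 : R}.
Local Notation cmu := (@completed_lebesgue_measure R).
Hypothesis S_semigroup : semigroup S.
Hypothesis M_ge1 : 1 <= M.
Hypothesis w_ge0 : 0 <= w.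
Hypothesis S_bound : forall t, 0 <= t -> op_norm (S t) <= M * expR (w * t).
Hypothesis CS_measurable : forall x : X,
  lebesgue_measurable_fun `[0, +oo[ (fun t => `|C (S t x)|).
Hypothesis g_pos : forall r, 0 < r -> 0 < g r.
Hypothesis h_increasing : forall r s, 0 < r -> r < s -> h r < h s.
Hypothesis C1_ge0 : 0 <= C1.
Hypothesis C2_ge1 : 1 <= C2.
Hypothesis uncertainty : forall l, 0 < l -> forall x : X,
  `|P l x| <= C1 * expR (f l) * `|C (P l x)|.
Hypothesis dissipation : forall l, 0 < l -> forall t, 0 < t -> t <= T ->
  forall x : X, `|S t x - P l (S t x)| <= C2 * expR (- g l * h t + w * t) * `|x|.

Let K := M * (C1 * op_norm C + 1) * C2.

Lemma semigroup_bound (t : R) (x : X) : 0 <= t -> `|S t x| <= M * expR (w * t) * `|x|.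
Proof.
move=> t0; apply: le_trans (ler_op_norm (S t) x) _.
by rewrite ler_wpM2r// S_bound.
Qed.

Lemma observation_integrable (x : X) :
  cmu.-integrable `[0, T] (EFin \o (fun t => `|C (S t x)|)).
Proof.
have [T0|T0] := ltP T 0.
  rewrite set_itv_ge; first exact: integrable_set0.
  by rewrite bnd_simp -ltNge.
have itv_meas (i : interval R) : measurable ([set` i] : set (lebesgueType R)).
  by apply: lebesgueType_measurable; exact: measurable_itv.
apply: measurable_bounded_integrable; first exact: itv_meas.
(* Finite measure of the closed interval follows by enclosing it in a half-open one. *)
- apply: (@le_lt_trans _ _ (cmu `]-1, T]%classic)).
    apply: le_measure; rewrite ?inE//.
    by apply: subset_itv; rewrite bnd_simp.
  by rewrite /= completed_lebesgue_measure_itv_bnd ?ltry// (le_trans _ T0).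
- apply: measurable_funS (CS_measurable x) => //.
  by apply: subset_itvl; rewrite bnd_simp.
- exists (op_norm C * (M * expR (w * T) * `|x|)); split; first exact: num_real.
  move=> r /ltW Br t /=; rewrite in_itv/= => /andP[t0 tT].
  rewrite normr_id; apply: le_trans (ler_op_norm C (S t x)) _; apply: le_trans Br.
  rewrite ler_wpM2l ?op_norm_ge0// (le_trans (semigroup_bound _ _ t0))//.
  by rewrite ler_wpM2r// ler_wpM2l ?(le_trans ler01)// ler_expR ler_wpM2l.
Qed.

(** Split [S t x] into [P l (S t x)] and a remainder. Dissipation from [a] to [t] makes the
    remainder of order [exp (- 4 m)]. The uncertainty relation costs [exp m] and sees [C (S t x)] up
    to [C] of the remainder, which leaves [exp (- 3 m)]. The semigroup bound then leads from [t] to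
    [b]. *)
Lemma pointwise_estimate (l m a t b r : R) (x : X) : 0 < l -> 0 < r -> f l = m ->
  g l * h r = 4 * m -> 0 <= m -> 0 <= a -> a + r <= t -> t <= b -> b <= T ->
  `|S b x| <= expR (w * (b - a)) *
    (M * C1 * expR m * `|C (S t x)| + K * expR (- 3 * m) * `|S a x|).
Proof.
move=> l0 r0 fl gh m0 a0 art tb bT.
have M0 : 0 <= M := le_trans ler01 M_ge1.
have C20 : 0 <= C2 := le_trans ler01 C2_ge1.
have ta : 0 < t - a by lra.
have t0 : 0 <= t by lra.
have Stx : S t x = S (t - a) (S a x).
  by rewrite -(S_semigroup.2 a (t - a)) ?subrK// ltW.
have Sbx : S b x = S (b - t) (S t x).
  by rewrite -(S_semigroup.2 t (b - t)) ?subrK// subr_ge0.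
set d := `|S t x - P l (S t x)|.
have d_le : d <= C2 * (expR (- 4 * m) * expR (w * (t - a))) * `|S a x|.
  rewrite /d Stx -expRD; apply: le_trans (dissipation _ l0 _ ta _ (S a x)) _; first by lra.
  rewrite ler_wpM2r// ler_wpM2l// ler_expR lerD2r mulNr mulNr lerN2 -gh.
  rewrite ler_wpM2l ?(ltW (g_pos _ l0))//.
  have [->//|rta] := eqVneq r (t - a).
  by apply/ltW/h_increasing => //; rewrite lt_neqAle rta/=; lra.
have P_le : `|P l (S t x)| <= C1 * expR m * (`|C (S t x)| + op_norm C * d).
  rewrite -fl; apply: le_trans (uncertainty _ l0 _) _.
  rewrite ler_wpM2l ?mulr_ge0 ?expR_ge0//.
  rewrite -[X in C X](subKr (S t x)) linearB/= (le_trans (ler_normB _ _))// lerD2l.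
  exact: ler_op_norm.
have St_le : `|S t x| <= C1 * expR m * `|C (S t x)| +
    (C1 * op_norm C + 1) * C2 * expR (- 3 * m) * expR (w * (t - a)) * `|S a x|.
  have tri : `|S t x| <= `|P l (S t x)| + d by rewrite -lerBlDl lerB_dist.
  have em1 : 1 <= expR m by rewrite -expR0 ler_expR.
  have cC : 0 <= C1 * op_norm C by rewrite mulr_ge0 ?op_norm_ge0.
  have coef : 0 <= C1 * expR m * op_norm C + 1.
    by rewrite addr_ge0// !mulr_ge0 ?expR_ge0 ?op_norm_ge0.
  have -> : (C1 * op_norm C + 1) * C2 * expR (- 3 * m) * expR (w * (t - a)) * `|S a x| =
      (C1 * op_norm C + 1) * expR m * (C2 * (expR (- 4 * m) * expR (w * (t - a))) * `|S a x|).
    by rewrite (_ : - 3 * m = m + - 4 * m) ?expRD; ring.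
  apply: (@le_trans _ _ (C1 * expR m * `|C (S t x)| + (C1 * expR m * op_norm C + 1) * d)).
    apply: le_trans tri _; apply: le_trans (lerD P_le (lexx d)) _.
    by rewrite le_eqVlt; apply/orP; left; apply/eqP; ring.
  rewrite lerD2l (le_trans (ler_wpM2l coef d_le))// ler_wpM2r//.
    by rewrite !mulr_ge0 ?expR_ge0.
  by rewrite mulrDl mul1r lerD// mulrAC.
rewrite Sbx; have bt0 : 0 <= b - t by rewrite subr_ge0.
apply: le_trans (semigroup_bound _ _ bt0) _.
have := ler_wpM2l (mulr_ge0 M0 (expR_ge0 (w * (b - t)))) St_le.
move/le_trans; apply.
(* The growth factors multiply exactly in the remainder term; in the observation term [b - t] is
   enlarged to [b - a] afterwards. *)
apply: (@le_trans _ _ (expR (w * (b - t)) * (M * C1 * expR m * `|C (S t x)|) +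
    expR (w * (b - a)) * (K * expR (- 3 * m) * `|S a x|))).
  rewrite (_ : w * (b - a) = w * (b - t) + w * (t - a)); last by ring.
  by rewrite [expR (_ + w * _)]expRD le_eqVlt; apply/orP; left; apply/eqP; rewrite /K; ring.
rewrite [leRHS]mulrDr lerD2r ler_wpM2r ?mulr_ge0 ?expR_ge0// ler_expR ler_wpM2l//.
by lra.
Qed.

(** Averaging the pointwise estimate over the second half, where [t - a > tau >= r], produces
    [1 / tau]. Only [r] is tied to [h], so [tau] may be enlarged to control [1 / tau]. *)
Lemma interval_estimate (l m a b r tau : R) (x : X) : 0 < l -> 0 < r -> f l = m ->
  g l * h r = 4 * m -> 0 <= m -> 0 <= a -> r <= tau -> b = a + 2 * tau -> b <= T ->
  `|S b x| <= expR (w * (b - a)) *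
    (M * C1 * expR m / tau * itv_integral (fun t => `|C (S t x)|) a b +
     K * expR (- 3 * m) * `|S a x|).
Proof.
move=> l0 r0 fl gh m0 a0 rtau bE bT.
have tau0 : 0 < tau := lt_le_trans r0 rtau.
have M0 : 0 <= M := le_trans ler01 M_ge1.
have A0 : 0 <= expR (w * (b - a)) * (M * C1 * expR m) by rewrite !mulr_ge0 ?expR_ge0.
have [am mb] : a <= a + tau /\ a + tau <= b by split; lra.
have := le_itv_integral _ T (fun t => normr_ge0 (C (S t x))) (observation_integrable x) a
  (a + tau) b (`|S b x| - expR (w * (b - a)) * (K * expR (- 3 * m) * `|S a x|)) _ a0 am mb bT A0.
rewrite (_ : b - (a + tau) = tau); last by lra.
rewrite -ler_pdivlMr// => J_ge; rewrite mulrDr -lerBlDr; apply: le_trans (J_ge _) _.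
  move=> t at_ tb; rewrite lerBlDr -[X in X + _]mulrA -mulrDr.
  by apply: (pointwise_estimate l m a t b r) => //; lra.
by rewrite le_eqVlt; apply/orP; left; apply/eqP; ring.
Qed.

End OneStep.

(** * Choice of the parameters and conclusion *)

Theorem theorem2p1 (R : realType) (X Y : completeNormedModType R)
    (C : 'L(X, Y)) (P : R -> 'L(X, X)) (S : R -> 'L(X, X)) (M omega : R)
    (f g h : R -> R) (T lambdaT C1 C2 : R)
    (S_semigroup : semigroup S)
    (M_ge1 : 1 <= M)
    (S_bound : forall t, 0 <= t -> op_norm (S t) <= M * expR (omega * t))
    (CS_measurable : forall x : X,
      lebesgue_measurable_fun `[0, +oo[ (fun t => `|C (S t x)|))
    (f_measurable : lebesgue_measurable_fun pos_reals f)
    (g_measurable : lebesgue_measurable_fun pos_reals g)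
    (h_measurable : lebesgue_measurable_fun pos_reals h)
    (g_pos : forall r, 0 < r -> 0 < g r)
    (f_bij : set_bij pos_reals pos_reals f)
    (h_bij : set_bij pos_reals pos_reals h)
    (f_increasing : forall r s, 0 < r -> r < s -> f r < f s)
    (h_increasing : forall r s, 0 < r -> r < s -> h r < h s)
    (g_decreasing : forall r s, 0 < r -> r <= s ->
      s / g (pos_inv f s) <= r / g (pos_inv f r))
    (T_gt0 : 0 < T)
    (lambdaT_ge0 : 0 <= lambdaT)
    (lambdaT_int :
      (\int[@completed_lebesgue_measure R]_(l in `]lambdaT, +oo[)
         (pos_inv h (4 * (l / g (pos_inv f l))) * (1 / l))%:E
       <= (ln 2 / 4 * Num.min 1 T)%:E)%E)
    (C1_ge0 : 0 <= C1)
    (C2_ge1 : 1 <= C2)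
    (uncertainty : forall l, 0 < l -> forall x : X,
      `|P l x| <= C1 * expR (f l) * `|C (P l x)|)
    (dissipation : forall l, 0 < l -> forall t, 0 < t -> t <= T -> forall x : X,
      `|S t x - P l (S t x)| <= C2 * expR (- g l * h t + omega * t) * `|x|) :
  let C3 := 8 * expR 1 ^+ 3 * M * C1 *
    (M * (C1 * op_norm C + 1) * C2) `^ (6 / (expR 1 * ln 2)) in
  exists Cobs : R, [/\ 0 <= Cobs,
    forall x : X,
      (`|S T x|%:E <= Cobs%:E *
         \int[@completed_lebesgue_measure R]_(t in `[0%R, T])
           `|C (S t x)|%:E)%E
    & Cobs <= C3 / T * expR (6 * lambdaT + Num.max omega 0 * T)].
Proof.
(* Passing to [w >= 0] only weakens both growth bounds and makes the growth factors monotone in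
   time. *)
move=> C3; set w := Num.max omega 0.
have w0 : 0 <= w by rewrite le_max lexx orbT.
have omega_le t : 0 <= t -> omega * t <= w * t.
  by move=> t0; rewrite ler_wpM2r// le_max lexx.
have M0 : 0 <= M := le_trans ler01 M_ge1.
have C20 : 0 <= C2 := le_trans ler01 C2_ge1.
have S_bound' t : 0 <= t -> op_norm (S t) <= M * expR (w * t).
  by move=> t0; rewrite (le_trans (S_bound t t0))// ler_wpM2l// ler_expR omega_le.
have dissipation' l : 0 < l -> forall t, 0 < t -> t <= T -> forall x : X,
    `|S t x - P l (S t x)| <= C2 * expR (- g l * h t + w * t) * `|x|.
  move=> l0 t t0 tT x; rewrite (le_trans (dissipation l l0 t t0 tT x))// ler_wpM2r//.
  by rewrite ler_wpM2l// ler_expR lerD2l omega_le// ltW.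
set K := M * (C1 * op_norm C + 1) * C2.
have K1 : 1 <= K.
  by rewrite /K !mulr_ege1// lerDr mulr_ge0// op_norm_ge0.
have lnK0 := ln_ge0 K1.
have e_gt0 : 0 < expR 1 * ln 2 :> R by rewrite mulr_gt0 ?expR_gt0 ?ln2_gt0.
pose c : R := 2 / (expR 1 * ln 2) * ln K.
have c0 : 0 <= c by rewrite mulr_ge0// divr_ge0// ltW.
(* The summand [2 * lambdaT] puts [m / 2] above [lambdaT], where the integral condition applies;
   [1 + c] is what [geometric_le_expR] requires. *)
pose m := 2 * lambdaT + 1 + c.
have m1 : 1 + c <= m by rewrite /m; lra.
have m0 : 0 < m by lra.
pose ratio l := l / g (pos_inv f l).
have ratio_gt0 l : 0 < l -> 0 < ratio l.
  by move=> l0; rewrite divr_gt0// g_pos// pos_inv_gt0.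
pose p l := pos_inv h (4 * ratio l).
have p_gt0 l : 0 < l -> 0 < p l.
  by move=> l0; rewrite pos_inv_gt0// mulr_gt0// ratio_gt0.
have p_ni l l' : 0 < l -> l <= l' -> p l' <= p l.
  move=> l0 ll'; have l'0 := lt_le_trans l0 ll'.
  apply: (le_pos_inv h_bij h_increasing _ _); first by rewrite mulr_gt0// ratio_gt0.
  by rewrite ler_wpM2l// g_decreasing.
have m2k_gt0 k : 0 < 2 ^+ k * m by rewrite mulr_gt0// exprn_gt0.
pose tau k := p (2 ^+ k * m) + T / 2 ^+ k.+3.
have tau_gt0 k : 0 < tau k.
  by rewrite addr_gt0 ?p_gt0// divr_gt0 ?exprn_gt0.
have sum_p n : \sum_(k < n) p (2 ^+ k * m) <= T / 4.
  (* The dyadic sum samples at right ends of blocks, so it is started at [m / 2] for its first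
     sample to be [p m]. *)
  have half_m : 0 < m / 2 by rewrite divr_gt0.
  have lm : lambdaT <= m / 2 by rewrite /m; lra.
  have := sum_doubling_le_integral p lambdaT (m / 2) half_m lambdaT_ge0 lm
    (fun l l0 => ltW (p_gt0 l l0)) p_ni n.
  move=> /le_trans/(_ lambdaT_int); rewrite lee_fin.
  rewrite (eq_bigr (fun k : 'I_n => p (2 ^+ k * m))); last first.
    by move=> k _; rewrite exprS; congr p; field.
  move=> sum_le; rewrite -(ler_pM2r (ln2_gt0 R)); apply: le_trans sum_le _.
  rewrite (_ : T / 4 * ln 2 = ln 2 / 4 * T); last by ring.
  by rewrite ler_wpM2l ?divr_ge0 ?(ltW (ln2_gt0 R))// ge_min lexx orbT.
have sum_geom n : \sum_(k < n) (T / 2 ^+ k.+3) = T / 4 * (1 - (2 ^+ n)^-1).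
  elim: n => [|n IH]; first by rewrite big_ord0 expr0 invr1 subrr mulr0.
  by rewrite big_ord_recr/= IH !exprS; field; rewrite expf_neq0.
pose t k := T - 2 * \sum_(i < k) tau i.
have tS k : t k = t k.+1 + 2 * tau k.
  by rewrite /t big_ord_recr/=; ring.
(* Each summand of [tau] adds up to at most [T / 4], so intervals of length [2 * tau k] fit into
   [[0, T]]. *)
have t_ge0 k : 0 <= t k.
  rewrite /t big_split/= sum_geom; have := sum_p k.
  have : 0 <= T / 4 * (2 ^+ k)^-1 by rewrite mulr_ge0 ?invr_ge0 ?exprn_ge0// ltW// divr_gt0.
  lra.
have t_dec k : t k.+1 <= t k by rewrite [leRHS]tS lerDl mulr_ge0// ltW.
have t0 : t 0%N = T by rewrite /t big_ord0 mulr0 subr0.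
have t_le k : t k <= T.
  elim: k => [|k IH]; first by rewrite t0.
  exact: le_trans IH.
(* Expanding [3 * m] yields [6 * lambdaT], the factor [e ^ 3] and the power of [K]; [powR] unfolds
   to an exponential because [K] is nonzero. *)
have CobsE : C3 / T * expR (6 * lambdaT + w * T) =
    8 / T * (M * C1) * expR (3 * m) * expR (w * T).
  rewrite /C3 -/K /powR gt_eqF ?(lt_le_trans ltr01)//.
  rewrite (_ : 3 * m = 6 * lambdaT + 1 * 3%:R + 6 / (expR 1 * ln 2) * ln K).
    by rewrite !expRD expRM_natr; ring.
  by rewrite /m /c; ring.
exists (C3 / T * expR (6 * lambdaT + w * T)); split => //.
  by rewrite CobsE !mulr_ge0 ?expR_ge0 ?invr_ge0// ltW.
move=> x; pose G t := `|C (S t x)|.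
have G0 t' : 0 <= G t' by exact: normr_ge0.
have G_int := observation_integrable (T := T) M_ge1 w0 S_bound' CS_measurable x.
pose J := itv_integral G.
(* Starting at [n = 1] avoids the integral over the empty interval []T, T]]. *)
have sum_J n : (0 < n)%N -> \sum_(k < n) J (t k.+1) (t k) = J (t n) T.
  case: n => // n _; elim: n => [|n IH]; first by rewrite big_ord1 t0.
  rewrite big_ord_recr/= IH addrC -(itv_integralD G T G_int (t n.+2) (t n.+1) T)//; exact: t_ge0.
have sum_J_le n : \sum_(k < n) J (t k.+1) (t k) <= J 0 T.
  have J_ge0 := itv_integral_ge0 G G0.
  have [->|n0] := posnP n; first by rewrite big_ord0.
  by rewrite sum_J// /J (itv_integralD G T G_int 0 (t n) T)// lerDr.
suff main : `|S T x| <= C3 / T * expR (6 * lambdaT + w * T) * J 0 T.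
  apply: (@le_trans _ _ ((C3 / T * expR (6 * lambdaT + w * T))%:E * (J 0 T)%:E)%E).
    by rewrite -EFinM lee_fin.
  apply: lee_wpmul2l; last exact: (itv_integral_le G T G0 G_int).
  by rewrite lee_fin CobsE !mulr_ge0 ?expR_ge0 ?invr_ge0// ltW.
rewrite CobsE.
have := @telescoping_estimate R K (M * C1) w T m (J 0 T) (M * expR (w * T) * `|x|)
  t (fun k => `|S (t k) x|) (fun k => J (t k.+1) (t k)) tau K1.
rewrite t0; apply=> //.
- by rewrite mulr_ge0.
- exact: itv_integral_ge0.
- by move=> k; rewrite /tau lerDr ltW// p_gt0.
- by move=> k; exact: itv_integral_ge0.
- move=> k; apply: le_trans (semigroup_bound S_bound' (t k) x (t_ge0 k)) _.
  by rewrite ler_wpM2r// ler_wpM2l// ler_expR ler_wpM2l.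
- move=> k; set mk := 2 ^+ k * m; have mk0 : 0 < mk := m2k_gt0 k.
  apply: (interval_estimate S_semigroup M_ge1 w0 S_bound' CS_measurable g_pos
    h_increasing C1_ge0 C2_ge1 uncertainty dissipation'
    (pos_inv f mk) mk (t k.+1) (t k) (p mk)) => //.
  + exact: pos_inv_gt0.
  + exact: p_gt0.
  + exact: pos_invK.
  (* With [l = pos_inv f mk], the choice of [p] means [h (p mk) = 4 * mk / g l]. *)
  + have ratio4_gt0 : 0 < 4 * ratio mk by rewrite mulr_gt0// ratio_gt0.
    rewrite /p (pos_invK h_bij _ ratio4_gt0) /ratio.
    by field; rewrite gt_eqF// g_pos// pos_inv_gt0.
  + exact: ltW.
  + by rewrite /tau lerDl divr_ge0 ?exprn_ge0// ltW.
Qed.
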